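(* Fix a real number $w>2$. For every $\varepsilon>0$ there exists $n_0$ (depending on $w$ and $\varepsilon$) such that for every $n>n_0$ and every symmetric equilibrium $S$ of the game $G(n;w)$, $$2-\varepsilon\le \frac{C_{n,w}(S)}{OPT(n,w)}\le 2+\varepsilon ,$$ where $OPT(n,w)$ is the optimal symmetric social cost.
   Context: The game $G(n;w)$ ($n\ge 2$ an integer, $w>1$ real): there are $n$ agents and discrete time steps $t=1,2,3,\dots$. Initially all agents are outside an empty first-come-first-served queue. At each time step: (1) each agent still outside decides, simultaneously with the others and possibly using independent randomization, whether to enter the queue; (2) all agents who decided to enter are appended to the end of the queue in uniformly random order; (3) if the queue is nonempty, the first agent in it is processed and leaves, and each remaining agent in the queue incurs cost $w$; (4) each agent outside the queue incurs cost $1$. Each agent minimizes his expected total cost (possibly $+\infty$). The state at the start of a step is $(m,k)$, where $m\ge1$ agents are still outside and $k\ge 0$ agents are in the queue, $m+k\le n$. An anonymous stationary strategy specifies, for each state $(m,k)$, a probability $q_{m,k}\in[0,1]$ of entering, used whenever that state occurs. A profile is symmetric if all agents use the same strategy. A symmetric equilibrium is a symmetric profile of anonymous stationary strategies in which no agent can strictly decrease his expected cost by unilaterally deviating to another anonymous stationary strategy. $c_{n,w}(S)$ is the expected cost of each agent under the symmetric profile $S$, and $C_{n,w}(S)=n\cdot c_{n,w}(S)$ is the social cost. The optimal symmetric social cost is $OPT(n,w)=\inf_S C_{n,w}(S)$, the infimum over all symmetric profiles $S$ of anonymous stationary strategies (not necessarily equilibria). *)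

(* Defs.v *)
From HB Require Import structures.
From mathcomp Require Import all_boot all_order all_algebra fingroup perm.
From mathcomp Require Import all_classical all_reals all_analysis.

Set Implicit Arguments.
Unset Strict Implicit.
Unset Printing Implicit Defensive.

Import Order.TTheory GRing.Theory Num.Theory.
Import numFieldNormedType.Exports.

Local Open Scope ring_scope.

(* Configuration of the game with agents 'I_n at the start of a step. An agent
   that is neither outside nor in the queue has been processed and has left. *)
Record config (n : nat) := Config {
  outside : {set 'I_n};
  queue : seq 'I_n  (* the head is the first in line *)
}.

Definition init_config (n : nat) : config n := Config [set: 'I_n] [::].

(* The agents of A enter in the order s, then the head of the queue leaves. *)
Definition advance (n : nat) (x : config n) (A : {set 'I_n}) (s : seq 'I_n) :
    config n :=
  Config (outside x :\: A) (behead (queue x ++ s)).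

Section Game.
Context {R : realType}.

(* [q m k] is the probability of entering when m agents are outside and k are
   in the queue. Values at pairs (m, k) that are not states are irrelevant. *)
Definition strategy := nat -> nat -> R.

Definition is_strategy (n : nat) (q : strategy) : Prop :=
  forall m k, (1 <= m)%N -> (m + k <= n)%N -> 0 <= q m k <= 1.

Definition profile (n : nat) := 'I_n -> strategy.

Definition sym_profile (n : nat) (q : strategy) : profile n := fun=> q.

Definition deviation (n : nat) (q q' : strategy) (i : 'I_n) : profile n :=
  fun j => if j == i then q' else q.

(* Probability that A is exactly the set of agents deciding to enter at x. *)
Definition entry_prob (n : nat) (p : profile n) (x : config n)
    (A : {set 'I_n}) : R :=
  \prod_(i in outside x)
    (let r := p i #|outside x| (size (queue x)) in if i \in A then r else 1 - r).

(* Conditional expectation of f after one step from x: the transition operator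
   of the Markov chain of configurations. The entrants are queued in uniformly
   random order. *)
Definition step_expect (n : nat) (p : profile n) (f : config n -> R)
    (x : config n) : R :=
  \sum_(A in powerset (outside x)) entry_prob p x A *
    ((\sum_(s <- permutations (enum A)) f (advance x A s)) / (#|A| `!)%:R).

(* Cost incurred by agent i in a step that ends in configuration x. *)
Definition step_cost (n : nat) (w : R) (i : 'I_n) (x : config n) : R :=
  if i \in outside x then 1 else if i \in queue x then w else 0.

(* Expected cost of agent i in time step t >= 1. By the Markov property, t
   iterations of the transition operator give the expectation of a function of
   the configuration reached after t steps. *)
Definition expected_step_cost (n : nat) (w : R) (p : profile n) (i : 'I_n)
    (t : nat) : R :=
  iter t (step_expect p) (step_cost w i) (init_config n).

(* The costs are nonnegative, so the expected total cost is the sum, possibly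
   +oo, of the expected costs of the steps. *)
Definition expected_cost (n : nat) (w : R) (p : profile n) (i : 'I_n) : \bar R :=
  (\sum_(1 <= t <oo) (expected_step_cost w p i t)%:E)%E.

Definition sym_equilibrium (n : nat) (w : R) (q : strategy) : Prop :=
  is_strategy n q /\
  forall (i : 'I_n) (q' : strategy), is_strategy n q' ->
    (expected_cost w (sym_profile q) i <=
     expected_cost w (deviation q q' i) i)%E.

(* By [social_costE] below, this is n times the cost of any one agent. *)
Definition social_cost (n : nat) (w : R) (q : strategy) : \bar R :=
  (\sum_(i < n) expected_cost w (sym_profile q) i)%E.

Definition opt_cost (n : nat) (w : R) : \bar R :=
  ereal_inf [set social_cost n w q | q in [set q | is_strategy n q]]%classic.

Definition relabel (n : nat) (g : {perm 'I_n}) (x : config n) : config n :=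
  Config (g @: outside x) (map g (queue x)).

Lemma relabel_step_expect (n : nat) (q : strategy) (g : {perm 'I_n})
    (f : config n -> R) (x : config n) :
  step_expect (sym_profile q) f (relabel g x) =
  step_expect (sym_profile q) (f \o relabel g) x.
Proof.
have gi : injective g by exact: perm_inj.
have gI : injective (fun A : {set 'I_n} => g @: A) by exact: imset_inj.
have gB : bijective (fun A : {set 'I_n} => g @: A) by exact: injF_bij.
rewrite /step_expect (reindex _ (onW_bij _ gB)) /=.
apply: eq_big => [A|A _].
  by rewrite !powersetE; apply/idP/idP => [|/imsetS->//];
     move=> /fintype.subsetP h; apply/fintype.subsetP => i iA;
     have := h _ (imset_f g iA); rewrite mem_imset.
congr (_ * _).
  rewrite /entry_prob /= big_imset /=; last by move=> i j _ _; exact: gi.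
  apply: eq_bigr => i _.
  by rewrite card_imset// size_map mem_imset.
rewrite card_imset//; congr (_ / _).
have hp : perm_eq (permutations (enum (g @: A)))
                  (map (map g) (permutations (enum A))).
  apply: uniq_perm; first exact: permutations_uniq.
    by rewrite map_inj_uniq ?permutations_uniq//; exact: inj_map.
  have he : perm_eq (enum (g @: A)) (map g (enum A)).
    apply: uniq_perm; rewrite ?enum_uniq ?map_inj_uniq ?enum_uniq// => i.
    rewrite mem_enum; apply/imsetP/mapP => -[j jA ->]; exists j => //;
    by rewrite ?mem_enum// in jA *.
  move=> s; rewrite mem_permutations (permPr he).
  apply/idP/mapP => [|[u]].
    move=> /(perm_map (g^-1)%g) /=.
    rewrite -map_comp (eq_map (permK g)) map_id => h.
    exists (map (g^-1)%g s); first by rewrite mem_permutations.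
    by rewrite -map_comp (eq_map (permKV g)) map_id.
  by rewrite mem_permutations => h ->; exact: perm_map.
rewrite (perm_big _ hp) /= big_map; apply: eq_bigr => s _ /=; congr f.
rewrite /advance /relabel /=; congr Config.
  apply/setP => i; rewrite -(permKV g i) !inE !mem_imset//.
  by rewrite !inE.
by rewrite -map_cat behead_map.
Qed.

Lemma expected_cost_sym (n : nat) (w : R) (q : strategy) (i j : 'I_n) :
  expected_cost w (sym_profile q) i = expected_cost w (sym_profile q) j.
Proof.
apply: eq_eseriesr => t _; congr EFin.
pose g := tperm i j.
have gi : injective g by exact: perm_inj.
have gj : g i = j by rewrite tpermL.
have key f x : iter t (step_expect (sym_profile q)) f (relabel g x) =
               iter t (step_expect (sym_profile q)) (f \o relabel g) x.
  elim: t x => //= t IH x; rewrite relabel_step_expect.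
  by congr step_expect; apply/funext => y /=; rewrite IH.
have g0 : relabel g (init_config n) = init_config n.
  rewrite /relabel /init_config /=; congr Config.
  by apply/setP => k; rewrite inE -(permKV g k) mem_imset ?inE.
rewrite /expected_step_cost -[in RHS]g0 key.
suff -> : step_cost w i = step_cost w j \o relabel g by [].
apply/funext => x /=; rewrite /step_cost /= -gj mem_imset//.
by rewrite (mem_map gi).
Qed.

Lemma social_costE (n : nat) (w : R) (q : strategy) (i : 'I_n) :
  social_cost n w q = (n%:R%:E * expected_cost w (sym_profile q) i)%E.
Proof.
rewrite /social_cost (eq_bigr (fun=> expected_cost w (sym_profile q) i)).
  rewrite mule_natl big_const_ord; move: (expected_cost _ _ i) => c.
  by elim: n {i} => [//|m IH]; rewrite iterS IH muleS.
by move=> j _; exact: expected_cost_sym.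
Qed.

End Game.

(* Main.v *)
Require Import Defs.
From mathcomp Require Import all_boot all_order all_algebra.
From mathcomp Require Import all_classical all_reals all_analysis.
From mathcomp Require Import ring lra zify.

(* The game of one agent against others who all play q is a Markov decision
   problem on the states (m, k). Let W be its value; an equilibrium q attains W
   and therefore meets only states in which both actions that it uses are
   optimal. If everybody entered for sure, entering would cost
   w (k + (m - 1) / 2) while waiting to be last costs at most k + m - 1; as
   w > 2, this rules out q = 1 unless the agent is alone. So never entering
   before everybody else has left is optimal, and the equilibrium cost is the
   expected time to serve the n - 1 others: n - 1 plus the expected idle time.
   At an empty queue, entering costs w (m - 1) q / 2, which is at least
   m - 1, hence q >= 2 / w and the total idle time is bounded by a geometric
   series. The equilibrium cost per agent is thus n + O(1). The optimal cost per
   agent is n / 2 + o(n): it is at least (n - 1) / 2 because one agent is served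
   per step, and entering in batches of about K agents whenever the queue is
   empty comes close to this. *)

Set Implicit Arguments.
Unset Strict Implicit.
Unset Printing Implicit Defensive.

Import Order.TTheory GRing.Theory Num.Theory.
Import numFieldNormedType.Exports.

Local Open Scope ring_scope.


(** * Expectations over a binomial number of entrants *)

Section Binomial.
Context {R : realType}.
Implicit Types (m : nat) (p : R) (f g : nat -> R).

(* Expectation of f at a binomial variable with parameters m and p. *)
Fixpoint Ebin m p f : R :=
  if m is m'.+1 then (1 - p) * Ebin m' p f + p * Ebin m' p (f \o S) else f 0%N.

Lemma eq_Ebin m p f g :
  (forall j, (j <= m)%N -> f j = g j) -> Ebin m p f = Ebin m p g.
Proof.
elim: m f g => [|m IH] f g /= fg; first exact: fg.
congr (_ * _ + _ * _); apply: IH => j jm; apply: fg => //.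
exact: leqW.
Qed.

Lemma EbinD m p f g : Ebin m p (fun j => f j + g j) = Ebin m p f + Ebin m p g.
Proof. by elim: m f g => //= m IH f g; rewrite !IH; ring. Qed.

Lemma EbinZ m p (a : R) f : Ebin m p (fun j => a * f j) = a * Ebin m p f.
Proof. by elim: m f => //= m IH f; rewrite !IH; ring. Qed.

Lemma Ebin_cst m p (a : R) : Ebin m p (fun=> a) = a.
Proof. by elim: m => //= m IH; rewrite IH; ring. Qed.

Lemma Ebin_mean m p : Ebin m p (fun j => j%:R) = m%:R * p.
Proof.
elim: m => [|m IH] /=; first by rewrite mul0r.
have -> : Ebin m p ((fun j => j%:R) \o S) = Ebin m p (fun j => 1 + j%:R).
  by apply: eq_Ebin => j _ /=; rewrite -natr1 addrC.
by rewrite EbinD Ebin_cst IH -natr1; ring.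
Qed.

Lemma Ebin_affine m p (a b : R) :
  Ebin m p (fun j => a + b * j%:R) = a + b * (m%:R * p).
Proof. by rewrite EbinD Ebin_cst EbinZ Ebin_mean. Qed.

Lemma Ebin_eq0 m p : Ebin m p (fun j => (j == 0%N)%:R) = (1 - p) ^+ m.
Proof.
elim: m => [|m IH] /=; first by rewrite expr0.
by rewrite IH exprS [X in _ + _ * X](Ebin_cst m p 0); ring.
Qed.

(* At [p = 0] only the value at [0] has positive weight. *)
Lemma ler_Ebin m p f g : 0 <= p <= 1 ->
  (forall j, (j <= m)%N -> (0 < p) || (j == 0%N) -> f j <= g j) ->
  Ebin m p f <= Ebin m p g.
Proof.
move=> /andP[p0 p1]; have [pp|] := ltP 0 p.
  elim: m f g => [|m IH] f g /= fg; first exact: fg.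
  apply: lerD; apply: ler_wpM2l => //; rewrite ?subr_ge0//; apply: IH => j jm _.
    by apply: fg => //; exact: leqW.
  exact: fg.
move=> p0'; have {p0 p0' p1} -> : p = 0 by apply/eqP; rewrite eq_le p0'.
have E h : Ebin m 0 h = h 0%N.
  by elim: m {f g} => //= m ->; rewrite subr0 mul1r mul0r addr0.
by move=> fg; rewrite !E; apply: fg; rewrite // orbT.
Qed.

Lemma Ebin_ge0 m p f : 0 <= p <= 1 -> (forall j, (j <= m)%N -> 0 <= f j) ->
  0 <= Ebin m p f.
Proof.
move=> p01 f0; rewrite -[leLHS](Ebin_cst m p); apply: ler_Ebin => // j jm _.
exact: f0.
Qed.

(** For [0 < p < 1] every value up to [m] has positive weight, and for [p = 0] only the value [0]
    has. This later carries the absence of slack from a state to its successors. *)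
Lemma Ebin_eq0_support m p f : 0 <= p < 1 -> (forall j, (j <= m)%N -> 0 <= f j) ->
  Ebin m p f <= 0 ->
  forall j, (j <= m)%N -> (0 < p) || (j == 0%N) -> f j <= 0.
Proof.
move=> /andP[p0 p1]; have p01 : 0 <= p <= 1 by rewrite p0 ltW.
elim: m f => [|m IH] f f0 /= fle [|j] jm pj //.
  have h1 : 0 <= Ebin m p f by apply: Ebin_ge0 => // j /leqW; exact: f0.
  have h2 : 0 <= Ebin m p (f \o S) by apply: Ebin_ge0 => // j jm'; exact: f0.
  apply: (IH f) => //; first by move=> i /leqW; exact: f0.
  have h3 : 0 <= p * Ebin m p (f \o S) by exact: mulr_ge0.
  rewrite -(pmulr_rle0 _ (_ : 0 < 1 - p)) ?subr_gt0//; lra.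
have {}pj : 0 < p by move: pj; rewrite orbF.
have h1 : 0 <= Ebin m p f by apply: Ebin_ge0 => // i /leqW; exact: f0.
apply: (IH (f \o S)) => //; [by move=> i im; exact: f0| |by rewrite pj].
have h3 : 0 <= (1 - p) * Ebin m p f by apply: mulr_ge0 => //; rewrite subr_ge0 ltW.
by rewrite -(pmulr_rle0 _ pj); lra.
Qed.

Lemma big_powersetU1 (T : finType) (i : T) (O : {set T}) (G : {set T} -> R) :
  i \notin O ->
  \sum_(A in powerset (i |: O)) G A = \sum_(A in powerset O) (G A + G (i |: A)).
Proof.
move=> iO; rewrite (bigID [pred A : {set T} | i \in A]) /= addrC big_split /=.
congr (_ + _).
  apply: eq_bigl => A; rewrite !powersetE; apply/andP/idP => [[AO iA]|AO].
    apply/fintype.subsetP => j jA; have := fintype.subsetP AO j jA.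
    by rewrite !inE => /orP[/eqP ji|//]; rewrite ji (negbTE iA) in jA.
  split; first by rewrite (fintype.subset_trans AO)// finset.subsetUr.
  by apply: contra iO => /(fintype.subsetP AO).
rewrite (reindex_onto (fun A => i |: A) (fun A => A :\ i)) /=; last first.
  by move=> A /andP[_ iA]; rewrite finset.setD1K.
apply: eq_bigl => A; rewrite !powersetE setU11 andbT.
apply/andP/idP => [[AO /eqP AE]|AO].
  apply/fintype.subsetP => j jA; have := fintype.subsetP AO j.
  by move: jA; rewrite -{1}AE !inE => /andP[/negPf-> /= ->]; exact.
split; first exact: finset.setUS.
by rewrite finset.setU1K//; apply: contra iO => /(fintype.subsetP AO).
Qed.

(** Independent decisions with a common probability make the number of entrants binomial; removing
    one agent from [O] matches the recursion of [Ebin]. *)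
Lemma sum_powerset_Ebin (T : finType) (O : {set T}) p (h : nat -> R) :
  \sum_(A in powerset O) (\prod_(j in O) if j \in A then p else 1 - p) * h #|A|
  = Ebin #|O| p h.
Proof.
elim: {O}#|O| {-2}O (erefl #|O|) h => [|m IH] O Om h.
  by rewrite (cards0_eq Om) powerset0 big_set1 big_set0 cards0 mul1r.
have /card_gt0P[i iO] : (0 < #|O|)%N by rewrite Om.
rewrite -(finset.setD1K iO); set O' := O :\ i.
have iO' : i \notin O' by rewrite !inE eqxx.
have O'm : #|O'| = m by move: Om; rewrite (cardsD1 i) iO add1n => -[].
rewrite big_powersetU1//= cardsU1 iO' O'm add1n /= -{1 2}O'm -!IH//.
rewrite !big_distrr /= -big_split /=.
apply: eq_bigr => A; rewrite powersetE => AO.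
have iA : i \notin A by apply: contra iO' => /(fintype.subsetP AO).
rewrite !big_setU1//= (negbTE iA) setU11 cardsU1 iA add1n !mulrA.
congr (_ * _ * _ + _ * _ * _); apply: eq_bigr => j jO'.
by rewrite !inE; case: eqP => // ji; rewrite -ji jO' in iO'.
Qed.

End Binomial.

(** * Random order of entry, and one step of the game seen by one agent *)

Lemma index_rev (T : eqType) (x : T) (s : seq T) :
  uniq s -> x \in s -> (index x s + index x (rev s))%N = (size s).-1.
Proof.
move=> us xs; have xs' : (index x s < size s)%N by rewrite index_mem.
have ur : uniq (rev s) by rewrite rev_uniq.
have -> : index x (rev s) = (size s - (index x s).+1)%N.
  have {1}-> : x = nth x (rev s) (size s - (index x s).+1).
    by rewrite nth_rev; [rewrite subnSK// subKn ?nth_index// ltnW|lia].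
  by rewrite index_uniq// size_rev; lia.
lia.
Qed.

(* Reversal of the order of entry exchanges [j] and [size e - 1 - j]. *)
Lemma sum_index_permutations (R : realType) (T : eqType) (x : T) (e : seq T) :
  uniq e -> x \in e ->
  \sum_(s <- permutations e) (index x s)%:R
    = (size e)`!%:R * ((size e).-1%:R / 2) :> R.
Proof.
move=> ue xe; pose S : R := \sum_(s <- permutations e) (index x s)%:R.
have hp : perm_eq (permutations e) (map rev (permutations e)).
  apply: uniq_perm; first exact: permutations_uniq.
    rewrite map_inj_uniq ?permutations_uniq//; exact: (can_inj revK).
  move=> s; rewrite mem_permutations; apply/idP/mapP => [se|[u + ->]].
    by exists (rev s); rewrite ?revK// mem_permutations perm_rev.
  by rewrite mem_permutations perm_rev.
have SS : S + S = (size e)`!%:R * (size e).-1%:R.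
  rewrite {2}/S (perm_big _ hp) /= big_map -big_split /=.
  rewrite (eq_big_seq (fun=> (size e).-1%:R)); last first.
    move=> s; rewrite mem_permutations => se; rewrite -natrD index_rev.
    - by rewrite (perm_size se).
    - by rewrite (perm_uniq se).
    - by rewrite (perm_mem se).
  by rewrite big_const_seq count_predT size_permutations// iter_addr addr0 mulr_natl.
by rewrite -/S; lra.
Qed.

(* Expected remaining costs, in state (m, k), of an agent who enters, and of one
   who stays out when a next state (m', k') is worth F m' k'; the m - 1 other
   agents outside enter with probability q m k. *)
Definition enter_cost (R : realType) (w : R) (q : @strategy R) (m k : nat) : R :=
  w * (k%:R + m.-1%:R * q m k / 2).

Definition stay_cost (R : realType) (q : @strategy R) (F : nat -> nat -> R)
    (m k : nat) : R :=
  1 + Ebin m.-1 (q m k) (fun j => F (m - j)%N (k + j).-1).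

Section Step.
Context {R : realType} {n : nat} (w : R) (i : 'I_n) (own oth : @strategy R).

(** The type [config] also allows repeated agents and agents both queued and outside; play preserves
    this invariant, which excludes them. *)
Definition valid (x : config n) :=
  uniq (queue x) && all (fun j => j \notin outside x) (queue x).

Lemma valid_advance (x : config n) (A : {set 'I_n}) (s : seq 'I_n) :
  valid x -> A \subset outside x -> s \in permutations (enum A) ->
  uniq (queue x ++ s) /\ valid (advance x A s).
Proof.
rewrite mem_permutations => /andP[uq /allP qo] /fintype.subsetP Ao sA.
have mA j : (j \in s) = (j \in A) by rewrite (perm_mem sA) mem_enum.
have uqs : uniq (queue x ++ s).
  rewrite cat_uniq uq (perm_uniq sA) enum_uniq andbT /=.
  by apply/hasPn => j; rewrite mA => /Ao jo; apply/negP => /qo; rewrite jo.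
split=> //; apply/andP; split=> /=; first by rewrite -drop1 drop_uniq.
apply/allP => j /mem_behead; rewrite mem_cat !inE mA => /orP[/qo/negPf->|->//].
by rewrite andbF.
Qed.

(** Later entrants stand behind a queued agent, so he pays exactly [w] per agent ahead of him. Only
    for an outside agent is a guess [F] needed. *)
Definition cost_to_go (F : nat -> nat -> R) (x : config n) : R :=
  if i \in outside x then F #|outside x| (size (queue x))
  else if i \in queue x then w * (index i (queue x))%:R else 0.

(** This evaluates the fixed policy [own]; it does not optimize over actions. *)
Definition bellman (F : nat -> nat -> R) (m k : nat) : R :=
  own m k * enter_cost w oth m k + (1 - own m k) * stay_cost oth F m k.

(** Here [L] is the queue before its head is served: whoever remains pays [w] and moves up one
    place. *)
Lemma cost_to_go_entered F (y : config n) (L : seq 'I_n) :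
  uniq L -> queue y = behead L -> i \notin outside y ->
  step_cost w i y + cost_to_go F y = if i \in L then w * (index i L)%:R else 0.
Proof.
rewrite /step_cost /cost_to_go => + -> /negPf->.
case: L => [|a L] /=; first by rewrite addr0.
move=> /andP[aL _]; rewrite inE eq_sym; case: eqP => [<-|_] /=.
  by rewrite (negPf aL) addr0 mulr0.
by case: ifP; rewrite ?addr0// -natr1; lra.
Qed.

(** Conditioning on the decision of agent [i], then on the number of other entrants, reduces the
    chain of configurations to the states [(m, k)]. *)
Lemma step_cost_to_go F (x : config n) : valid x ->
  step_expect (deviation oth own i) (fun y => step_cost w i y + cost_to_go F y) x
  = cost_to_go (bellman F) x.
Proof.
move=> vx; have [uq /allP qo] := andP vx.
pose c y := step_cost w i y + cost_to_go F y; rewrite -/c /step_expect.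
pose O := outside x; pose m := #|O|; pose k := size (queue x).
have avg (A : {set 'I_n}) v :
    (forall s, s \in permutations (enum A) -> c (advance x A s) = v) ->
    (\sum_(s <- permutations (enum A)) c (advance x A s)) / (#|A| `!)%:R = v.
  move=> cv; rewrite (eq_big_seq _ cv) big_const_seq count_predT.
  rewrite size_permutations ?enum_uniq// -cardE iter_addr addr0.
  by rewrite -[v *+ _]mulr_natr mulfK.
have [iO|iO] := boolP (i \in O); last first.
  rewrite (eq_bigr (fun A => entry_prob (deviation oth own i) x A *
      cost_to_go (bellman F) x)).
    rewrite -big_distrl /= [X in X * _](_ : _ = 1) ?mul1r//.
    transitivity (Ebin #|O| (oth m k) (fun=> 1)); last exact: Ebin_cst.
    rewrite -sum_powerset_Ebin; apply: eq_bigr => A _; rewrite mulr1.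
    apply: eq_bigr => j jO; rewrite /deviation; case: eqP => // ji.
    by rewrite -ji jO in iO.
  move=> A; rewrite powersetE => AO; congr (_ * _); apply: avg => s sA.
  have [uqs _] := valid_advance vx AO sA.
  rewrite /c (cost_to_go_entered _ uqs)//=; last by rewrite inE (negPf iO) andbF.
  have iA : i \notin A by apply: contra iO => /(fintype.subsetP AO).
  have is_ : i \notin s.
    by move: sA; rewrite mem_permutations => /perm_mem->; rewrite mem_enum.
  rewrite /cost_to_go (negPf iO) mem_cat (negPf is_) orbF index_cat.
  by case: ifP => [->|_].
rewrite /cost_to_go iO -/m -/k /bellman /enter_cost /stay_cost.
pose O' := O :\ i; have iO' : i \notin O' by rewrite !inE eqxx.
have OE : O = i |: O' by rewrite finset.setD1K.
have O'm : #|O'| = m.-1 by rewrite /m (cardsD1 i O) iO.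
have iq : i \notin queue x by apply/negP => /qo; rewrite iO.
rewrite -/O OE big_powersetU1//.
pose Pr (A : {set 'I_n}) : R := \prod_(j in O') if j \in A then oth m k else 1 - oth m k.
have prE A : entry_prob (deviation oth own i) x A =
    (if i \in A then own m k else 1 - own m k) * Pr A.
  rewrite /entry_prob -/O OE big_setU1//= -OE; congr (_ * _).
    by rewrite /deviation eqxx.
  apply: eq_bigr => j jO'; rewrite /deviation; case: eqP => // ji.
  by rewrite -ji jO' in iO'.
have sumPr h : \sum_(A in powerset O') Pr A * h #|A| = Ebin m.-1 (oth m k) h.
  by rewrite sum_powerset_Ebin O'm.
(* Among [j] other entrants the average position of the agent is [j / 2], hence the slope
   [w / 2]. *)
have -> : w * (k%:R + m.-1%:R * oth m k / 2)
    = Ebin m.-1 (oth m k) (fun j => w * k%:R + w / 2 * j%:R).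
  by rewrite Ebin_affine; lra.
have -> : 1 + Ebin m.-1 (oth m k) (fun j => F (m - j)%N (k + j).-1)
    = Ebin m.-1 (oth m k) (fun j => 1 + F (m - j)%N (k + j).-1).
  by rewrite EbinD Ebin_cst.
rewrite -!sumPr !big_distrr /=.
rewrite -big_split /=; apply: eq_bigr => A; rewrite powersetE => AO'.
have iA : i \notin A by apply: contra iO' => /(fintype.subsetP AO').
rewrite [RHS]addrC !prE (negPf iA) setU11; congr (_ + _); last first.
  have AO : i |: A \subset O by rewrite OE finset.setUS.
  have PrE : Pr (i |: A) = Pr A.
    apply: eq_bigr => j jO'; rewrite !inE; case: eqP => // ji.
    by rewrite -ji jO' in iO'.
  rewrite PrE -!mulrA; congr (_ * (_ * _)).
  rewrite (eq_big_seq (fun s => w * k%:R + w * (index i s)%:R)); last first.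
    move=> s sA; have [uqs _] := valid_advance vx AO sA.
    rewrite /c (cost_to_go_entered _ uqs)//=; last by rewrite !inE eqxx.
    have is_ : i \in s.
      by move: sA; rewrite mem_permutations => /perm_mem->; rewrite mem_enum !inE eqxx.
    by rewrite mem_cat is_ orbT index_cat (negPf iq) natrD mulrDr.
  rewrite big_split /= -[X in _ + X]mulr_sumr.
  rewrite sum_index_permutations ?enum_uniq//; last first.
    by rewrite mem_enum !inE eqxx.
  rewrite big_const_seq count_predT size_permutations ?enum_uniq// -cardE.
  rewrite iter_addr addr0 cardsU1 iA add1n /= -mulr_natr.
  by field; rewrite pnatr_eq0 -lt0n fact_gt0.
have AO : A \subset O by rewrite OE (fintype.subset_trans AO')// finset.subsetUr.
rewrite -!mulrA; congr (_ * (_ * _)); apply: avg => s sA.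
have iOA : i \in O :\: A by rewrite inE iA.
rewrite /c /cost_to_go /step_cost /= -/O iOA cardsD (finset.setIidPr AO) -/m.
congr (_ + F _ _).
rewrite size_behead size_cat -/k; congr (_ + _).-1.
by move: sA; rewrite mem_permutations => /perm_size->; rewrite -cardE.
Qed.

End Step.

(** * Bounds on the total cost by iterating the one-step operator *)

Definition state (n m k : nat) : bool := (0 < m)%N && (m + k <= n)%N.

Section Cost.
Context {R : realType} {n : nat} (w : R) (i : 'I_n) (own oth : @strategy R).
Context (own01 : is_strategy n own) (oth01 : is_strategy n oth).

Lemma strategy01 (q : @strategy R) m k : is_strategy n q -> state n m k -> 0 <= q m k <= 1.
Proof. by move=> q01 /andP[]; exact: q01. Qed.

Lemma state_next m k j : state n m k -> (j <= m.-1)%N -> state n (m - j) (k + j).-1.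
Proof. by rewrite /state; lia. Qed.

Lemma state_init : state n n 0.
Proof. by rewrite /state addn0 leqnn andbT (leq_ltn_trans _ (ltn_ord i)). Qed.

Local Notation B := (bellman w own oth).
Local Notation E := (step_expect (deviation oth own i)).
Local Notation c := (step_cost w i).
Local Notation e := (expected_step_cost w (deviation oth own i) i).

Lemma bellman_le (F G : nat -> nat -> R) :
  (forall m k, state n m k -> F m k <= G m k) ->
  forall m k, state n m k -> B F m k <= B G m k.
Proof.
move=> FG m k smk; have /andP[_ p1] := strategy01 own01 smk.
rewrite lerD2l ler_wpM2l ?subr_ge0// lerD2l; apply: ler_Ebin.
  exact: strategy01.
by move=> j jm _; apply: FG; exact: state_next.
Qed.

Lemma step_expectD (f g : config n -> R) x :
  E (fun y => f y + g y) x = E f x + E g x.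
Proof.
rewrite -big_split; apply: eq_bigr => A _ /=.
by rewrite big_split /= mulrDl mulrDr.
Qed.

Lemma step_expectZ (a : R) (f : config n -> R) x :
  E (fun y => a * f y) x = a * E f x.
Proof.
rewrite [RHS]big_distrr; apply: eq_bigr => A _ /=.
by rewrite -big_distrr /=; ring.
Qed.

Lemma valid_state (x : config n) : valid x -> (#|outside x| + size (queue x) <= n)%N.
Proof.
move=> /andP[uq /allP qo]; have := max_card (mem (outside x :|: [set j in queue x])).
rewrite cardsU card_ord cardsE (card_uniqP uq) (_ : _ :&: _ = finset.set0).
  by rewrite cards0 subn0.
by apply/setP => j; rewrite !inE; apply/andP => -[jo /qo]; rewrite jo.
Qed.

Lemma step_expect_le (f g : config n -> R) :
  (forall y, valid y -> f y <= g y) ->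
  forall x, valid x -> E f x <= E g x.
Proof.
move=> fg x vx; apply: ler_sum => A; rewrite powersetE => AO.
apply: ler_wpM2l.
  apply: prodr_ge0 => j jO /=; rewrite /deviation.
  have /(strategy01 _) st : state n #|outside x| (size (queue x)).
    by rewrite /state valid_state// andbT; apply/card_gt0P; exists j.
  have /andP[p0 p1] := st _ own01; have /andP[q0 q1] := st _ oth01.
  by case: ifP; case: ifP => _ _; rewrite ?subr_ge0.
rewrite ler_wpM2r ?invr_ge0// !big_seq; apply: ler_sum => s sA.
by apply: fg; have [] := valid_advance vx AO sA.
Qed.

Lemma iter_step_le t (f g : config n -> R) :
  (forall y, valid y -> f y <= g y) ->
  forall x, valid x -> iter t E f x <= iter t E g x.
Proof. by move=> fg; elim: t => // t IH; exact: step_expect_le. Qed.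

Lemma eq_iter_step t (f g : config n -> R) :
  (forall y, valid y -> f y = g y) ->
  forall x, valid x -> iter t E f x = iter t E g x.
Proof.
by move=> fg x vx; apply/eqP; rewrite eq_le !iter_step_le// => y /fg->.
Qed.

Lemma iter_stepD t (f g : config n -> R) x :
  iter t E (fun y => f y + g y) x = iter t E f x + iter t E g x.
Proof.
elim: t x => // t IH x; rewrite -step_expectD /=; congr step_expect.
exact/funext.
Qed.

Lemma iter_stepZ t (a : R) (f : config n -> R) x :
  iter t E (fun y => a * f y) x = a * iter t E f x.
Proof.
elim: t x => // t IH x; rewrite -step_expectZ /=; congr step_expect.
exact/funext.
Qed.

Lemma iter_step_ge0 t (f : config n -> R) :
  (forall y, valid y -> 0 <= f y) -> forall x, valid x -> 0 <= iter t E f x.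
Proof.
move=> f0 x vx; rewrite -[leLHS](mul0r (iter t E f x)) -iter_stepZ.
by apply: iter_step_le => // y vy; rewrite mul0r f0.
Qed.

Context (w0 : 0 <= w).

Lemma step_cost_ge0 (x : config n) : 0 <= c x.
Proof. by rewrite /step_cost; do 2 case: ifP => //. Qed.

Lemma expected_step_cost_ge0 t : 0 <= e t.
Proof. by apply: iter_step_ge0 => // y _; exact: step_cost_ge0. Qed.

(** Telescoping: each application of [bellman] accounts for the cost of one step, and [F] gives the
    terminal cost. *)
Lemma partial_cost N F (x : config n) : valid x ->
  \sum_(1 <= t < N.+1) iter t E c x + iter N E (cost_to_go w i F) x
  = cost_to_go w i (iter N B F) x.
Proof.
elim: N F x => [|N IH] F x vx; first by rewrite big_geq// add0r.
rewrite big_nat_recr//= -addrA.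
rewrite -[E _ x + _]/(iter N.+1 E c x + iter N.+1 E (cost_to_go w i F) x).
rewrite -iter_stepD iterSr -[RHS]/(cost_to_go w i (iter N.+1 B F) x) iterSr -IH//.
by congr (_ + _); apply: eq_iter_step => // y vy; exact: step_cost_to_go.
Qed.

Lemma partial_cost_init N F :
  \sum_(1 <= t < N.+1) e t + iter N E (cost_to_go w i F) (init_config n)
  = iter N B F n 0%N.
Proof. by rewrite partial_cost// /cost_to_go/= inE cardsT card_ord. Qed.

(** Verification by a supersolution: the nonnegative terminal cost is dropped, and monotonicity
    keeps every iterate below [F]. *)
Lemma cost_le (F : nat -> nat -> R) :
  (forall m k, state n m k -> 0 <= F m k) ->
  (forall m k, state n m k -> B F m k <= F m k) ->
  (expected_cost w (deviation oth own i) i <= (F n 0%N)%:E)%E.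
Proof.
move=> F0 BF; have e0 t : (0%N <= t)%N -> true -> (0 <= (e t)%:E)%E.
  by move=> _ _; rewrite lee_fin expected_step_cost_ge0.
apply: lime_le; first by apply: is_cvg_nneseries => t _ _; apply: e0.
apply: nearW => -[|N].
  by rewrite big_geq// lee_fin F0// state_init.
rewrite sumEFin lee_fin; apply: (@le_trans _ _ (iter N B F n 0%N)).
  rewrite -partial_cost_init lerDl; apply: iter_step_ge0 => // y vy.
  rewrite /cost_to_go; case: ifP => [iy|_]; last by case: ifP => // _; exact: mulr_ge0.
  by apply: F0; rewrite /state valid_state// andbT; apply/card_gt0P; exists i.
have : forall m k, state n m k -> iter N B F m k <= F m k.
  elim: N => // N IH m k smk; apply: le_trans (BF _ _ smk).
  exact: bellman_le.
by apply; exact: state_init.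
Qed.

(** If the total cost were a finite [r < a], the terminal cost would stay above [a - r]; the step
    costs would then be bounded away from zero and have infinite sum. *)
Lemma cost_ge (F : nat -> nat -> R) (M a : R) (N0 : nat) :
  (forall m k, state n m k -> F m k <= M) ->
  (forall N, (N0 <= N)%N -> a <= iter N B F n 0%N) ->
  (a%:E <= expected_cost w (deviation oth own i) i)%E.
Proof.
move=> FM aB; pose P N := \sum_(1 <= t < N.+1) e t.
have Pcost N : ((P N)%:E <= expected_cost w (deviation oth own i) i)%E.
  rewrite -sumEFin; apply: (@nneseries_lim_ge _ (fun t => (e t)%:E) xpredT) => t _ _.
  by rewrite lee_fin expected_step_cost_ge0.
move: Pcost; case: (expected_cost _ _ _) => [r Pr|_|/(_ 0%N)//]; last exact: leey.
rewrite lee_fin leNgt; apply/negP => ra.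
(* [L] times the current step cost dominates the remaining cost: [M] serves for an outside agent,
   [n] for a position in the queue. *)
pose L := Num.max M n%:R + 1.
have ML : M <= L.
  by rewrite /L (le_trans _ (_ : Num.max M n%:R <= _))// ?le_max ?lexx// lerDl.
have nL : n%:R <= L.
  rewrite /L (le_trans _ (_ : Num.max M n%:R <= _))// ?le_max ?lexx ?orbT//.
  by rewrite lerDl.
have L0 : 0 < L.
  by rewrite /L (lt_le_trans (ltr01))// lerDr le_max ler0n orbT.
have eN N : (N0 <= N)%N -> (a - r) / L <= e N.
  move=> NN0; rewrite ler_pdivrMr// mulrC.
  suff : a <= P N + L * e N by have := Pr N; rewrite lee_fin; lra.
  apply: (le_trans (aB N NN0)); rewrite -partial_cost_init lerD2l -iter_stepZ.
  apply: iter_step_le => // y vy; rewrite /cost_to_go /step_cost.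
  case: ifP => [iy|_].
    rewrite mulr1 (le_trans _ ML)// FM// /state valid_state// andbT.
    by apply/card_gt0P; exists i.
  case: ifP => [iy|_]; last by rewrite mulr0.
  rewrite mulrC ler_wpM2r// (le_trans _ nL)// ler_nat.
  apply: leq_trans (index_size _ _) _.
  exact: leq_trans (leq_addl _ _) (valid_state vy).
have PK K : K%:R * ((a - r) / L) <= P (N0 + K)%N.
  elim: K => [|K IH].
    by rewrite mul0r sumr_ge0// => t _; exact: expected_step_cost_ge0.
  rewrite addnS /P big_nat_recr//= -/(P _) -natr1 mulrDl mul1r lerD// eN//.
  by rewrite leqW// leq_addr.
have d0 : 0 < (a - r) / L by rewrite divr_gt0// subr_gt0.
pose K := Num.bound `|r / ((a - r) / L)|.
have := Pr (N0 + K)%N; rewrite lee_fin leNgt => /negP; apply.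
apply: lt_le_trans (PK K).
rewrite -ltr_pdivrMr//; apply: le_lt_trans (ler_norm _) _.
exact: archi_boundP.
Qed.

End Cost.

(** * Bounds on the cost of symmetric profiles *)

Section Optimum.
Context {R : realType} {n : nat} (w : R) (i : 'I_n).

Lemma deviation_id (q : @strategy R) : deviation q q i = sym_profile q.
Proof. by apply/funext => j; rewrite /deviation if_same. Qed.

(* The potential is the average cost of the outside agents when the queue is
   never idle and waiting anywhere costs 1 per step. *)
Lemma sym_cost_ge (q : @strategy R) : 1 <= w -> is_strategy n q ->
  ((n.-1%:R / 2)%:E <= expected_cost w (sym_profile q) i)%E.
Proof.
move=> w1 q01; have w0 : 0 <= w by exact: le_trans w1.
pose F (m k : nat) : R := k%:R + m.-1%:R / 2.
have FBF m k : state n m k -> F m k <= bellman w q q F m k.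
  case: m => // m smk; have /andP[p0 p1] := strategy01 q01 smk.
  rewrite /F /bellman /enter_cost /stay_cost /=; set p := q _ _ in p0 p1 *.
  have : k%:R - 1 + m%:R / 2 + 1 / 2 * (m%:R * p) <=
      Ebin m p (fun j => (k + j).-1%:R + (m.+1 - j).-1%:R / 2).
    rewrite -Ebin_affine; apply: ler_Ebin; first by rewrite p0.
    move=> j jm _; rewrite subSn//= natrB//.
    have : (k + j)%:R <= (k + j).-1%:R + 1 :> R by rewrite natr1 ler_nat leqSpred.
    by rewrite natrD; lra.
  set X := Ebin _ _ _ => leX; have k0 : 0 <= k%:R :> R by [].
  have mp0 : 0 <= m%:R * p by rewrite mulr_ge0.
  have h1 : 0 <= p * ((w - 1) * (k%:R + m%:R * p / 2)).
    by rewrite !mulr_ge0 ?subr_ge0// addr_ge0// divr_ge0.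
  have h2 : 0 <= (1 - p) * (X - (k%:R - 1 + m%:R / 2 + 1 / 2 * (m%:R * p))).
    by rewrite mulr_ge0 ?subr_ge0.
  lra.
rewrite -deviation_id; apply: (@cost_ge _ _ _ _ _ _ q01 q01 w0 F (n%:R + n%:R) _ 0%N).
  move=> m k /andP[m0 mkn]; rewrite /F lerD ?ler_nat//.
    exact: leq_trans (leq_addl _ _) mkn.
  have : m.-1%:R <= n%:R :> R by rewrite ler_nat; lia.
  have : 0 <= m.-1%:R :> R by []; lra.
move=> N _; have -> : n.-1%:R / 2 = F n 0%N by rewrite /F add0r.
have : forall m k, state n m k -> F m k <= iter N (bellman w q q) F m k.
  elim: N => // N IH m k smk; apply: (le_trans (FBF _ _ smk)).
  exact: (bellman_le w q01 q01 IH).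
by apply; exact: state_init.
Qed.

(** Bounds the probability that nobody enters. The induction rests on
    [(1 - p) * (1 + (m + 1) * p) <= 1 + m * p]. *)
Lemma exp1B_bernoulli (p : R) m : 0 <= p <= 1 -> (1 - p) ^+ m * (1 + m%:R * p) <= 1.
Proof.
move=> /andP[p0 p1]; elim: m => [|m]; first by rewrite expr0 mul0r addr0 mulr1.
apply: le_trans; rewrite exprSr -mulrA ler_wpM2l ?exprn_ge0 ?subr_ge0//.
have h : 0 <= m%:R * (p * p) by rewrite !mulr_ge0.
by rewrite -natr1; have := sqr_ge0 p; rewrite expr2; lra.
Qed.

Definition batch (K : nat) : @strategy R := fun m k =>
  if k is 0%N then (if (m <= K)%N then 1 else K%:R / m%:R) else 0.

Lemma batch_strategy K : is_strategy n (batch K).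
Proof.
move=> m [|k] m0 _; rewrite /batch ?lexx ?ler01//.
case: leqP => mK; first by rewrite lexx ler01.
by rewrite divr_ge0// ler_pdivrMr ?ltr0n// mul1r ler_nat ltnW.
Qed.

(* A round started with m agents outside is idle with probability at most
   1/(1+K), and serves K agents on average; this fixes the slope of the potential. *)
Lemma batch_cost_le (K : nat) : 0 <= w -> (0 < K)%N ->
  (expected_cost w (sym_profile (batch K)) i <=
   ((1 / 2 + 1 / (2 * K%:R * (1 + K%:R))) * n%:R + w * K%:R / 2)%:E)%E.
Proof.
move=> w0 K0; set a := 1 / 2 + _; set b := w * K%:R / 2.
have KR : 1 <= K%:R :> R by rewrite ler1n.
have Kn0 : K%:R != 0 :> R by rewrite pnatr_eq0 -lt0n.
have K1n0 : 1 + K%:R != 0 :> R by rewrite gt_eqF// ltr_wpDr.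
(* Equivalently [(1 - a) * K + 1 / (1 + K) = a * K], the balance that closes the case of an empty
   queue with more than [K] agents outside. The constant [b] is the cost of entering along with [K]
   others. *)
have aK : a * K%:R + a * K%:R = K%:R + (1 + K%:R)^-1.
  by rewrite /a; field; rewrite Kn0 K1n0.
have a0 : 0 <= a by rewrite /a addr_ge0// divr_ge0// !mulr_ge0// addr_ge0.
have a1 : a <= 1.
  have i1 : (1 + K%:R)^-1 <= 1 :> R by rewrite invf_le1 ?ltr_wpDr// lerDl.
  by rewrite -(ler_pM2r (_ : 0 < K%:R)) ?ltr0n//; lra.
have b0 : 0 <= b by rewrite divr_ge0// mulr_ge0.
pose F (m k : nat) : R := k%:R + a * m%:R + b.
have -> : a * n%:R + b = F n 0%N by rewrite /F add0r.
have s01 := batch_strategy K.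
rewrite -deviation_id; apply: (cost_le i s01 s01 w0).
  by move=> m k _; rewrite /F !addr_ge0// mulr_ge0.
case=> [//|m] [|k] smk; rewrite /bellman /enter_cost /stay_cost /F /=; last first.
  rewrite subr0 !mul0r add0r mul1r.
  rewrite (@eq_Ebin _ _ _ _ (fun j => k%:R + a * m.+1%:R + b + (1 - a) * j%:R)).
    by rewrite Ebin_affine mulr0 mulr0 addr0 -natr1; lra.
  by move=> j jm; rewrite natrD natrB; [lra|exact: leqW].
have := strategy01 s01 smk; rewrite /batch; set p : R := (if _ then _ else _).
move=> p01; have /andP[p0 p1] := p01.
(* The truncated predecessor [(0 + j).-1] exceeds [j - 1] only at [j = 0], by one: this is the idle
   step. *)
rewrite (@eq_Ebin _ _ _ _ (fun j =>
    (a * m.+1%:R + b - 1 + (1 - a) * j%:R) + (j == 0%N)%:R)); last first.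
  move=> [|j] jm; rewrite add0n ?subn0/=; first by lra.
  by rewrite natrB//; [have := natr1 j : _ = _ :> R; lra|exact: leqW].
rewrite EbinD Ebin_affine Ebin_eq0 add0r.
rewrite /p; case: leqP => mK; last first.
  rewrite subrr mul0r addr0 mul1r mulr1 /b.
  have h : w * m%:R <= w * K%:R by rewrite ler_wpM2l// ler_nat ltnW.
  have : 0 <= a * m.+1%:R by rewrite mulr_ge0.
  lra.
have pE : p = K%:R / m.+1%:R by rewrite /p ltnNge mK.
rewrite -pE; have pm : p * m.+1%:R = K%:R by rewrite pE divfK// pnatr_eq0.
have pm' : m%:R * p <= K%:R by rewrite -pm mulrC ler_wpM2l// ler_nat.
have pm0 : 0 <= m%:R * p by rewrite mulr_ge0.
have X : (1 - p) * (1 - p) ^+ m <= (1 + K%:R)^-1.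
  rewrite -exprS -[leRHS]mul1r ler_pdivlMr; last by lra.
  by have := exp1B_bernoulli m.+1 p01; rewrite [_ * p]mulrC pm.
have h1 : 0 <= p * (w * (K%:R - m%:R * p)) by rewrite !mulr_ge0// subr_ge0.
have h2 : 0 <= (1 - a) * (p * (m%:R * p)) by rewrite !mulr_ge0// ?subr_ge0// mulr_ge0.
have h3 : 0 <= (1 - a) * (K%:R - m%:R * p) by rewrite mulr_ge0 ?subr_ge0.
have apm : a * (p * m.+1%:R) = a * K%:R by rewrite pm.
rewrite /b; lra.
Qed.

End Optimum.

(** * Existence of the value of the best-response problem *)

Lemma Ebin_p1 (R : realType) m (f : nat -> R) : Ebin m 1 f = f m.
Proof. by elim: m f => //= m IH f; rewrite subrr mul0r add0r mul1r IH. Qed.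

(* Here r is the contribution of the states reached by leaving the current one,
   and b is the probability of remaining in it. *)
Lemma min_fixpoint (R : realType) (b c r : R) :
  0 <= b <= 1 -> 0 <= c -> 0 <= r -> (b = 1 -> c = 0) ->
  exists2 v, 0 <= v & v = Num.min c (1 + r + b * v).
Proof.
move=> /andP[b0]; rewrite le_eqVlt => /orP[/eqP-> c0 r0 /(_ erefl)->|b1 c0 r0 _].
  by exists 0 => //; rewrite minEle ifT// mulr0 addr0 addr_ge0.
have d0 : 0 < 1 - b by rewrite subr_gt0.
(* [u] is the cost of staying out until the state is left: it solves [u = 1 + r + b * u]. *)
pose u := (1 + r) / (1 - b); have uE : u * (1 - b) = 1 + r by rewrite divfK ?gt_eqF.
have [cu|uc] := leP c u.
  exists c => //; rewrite minEle ifT//.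
  have : c * (1 - b) <= u * (1 - b) by rewrite ler_pM2r.
  lra.
exists u; first by apply: divr_ge0; [exact: addr_ge0|exact: ltW].
by rewrite minEge ifT; lra.
Qed.

Section Value.
Context {R : realType} (n : nat) (w : R) (q : @strategy R).
Context (w0 : 0 <= w) (q01 : is_strategy n q).

Lemma enter_cost_ge0 m k : state n m k -> 0 <= enter_cost w q m k.
Proof.
move=> smk; have /andP[p0 _] := strategy01 q01 smk.
by rewrite mulr_ge0// addr_ge0// divr_ge0// mulr_ge0.
Qed.

(** While the agent stays out, the rank [2 * m + k] drops at every step except an idle one, which
    repeats [(m, 0)]. Induction on the rank thus leaves one scalar equation per state. *)
Lemma value_exists_below N : exists2 W : nat -> nat -> R,
  forall m k, 0 <= W m k &
  forall m k, state n m k -> (2 * m + k < N)%N ->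
    W m k = Num.min (enter_cost w q m k) (stay_cost q W m k).
Proof.
elim: N => [|N [W W0 WE]]; first by exists (fun _ _ => 0).
(* The default [0] at rank [N] removes the idle step from [r]; the term with [b] restores it. *)
pose W' (m k : nat) : R := if (2 * m + k < N)%N then W m k else 0.
have W'0 m k : 0 <= W' m k by rewrite /W'; case: ifP.
pose b m k : R := if k is 0%N then (1 - q m k) ^+ m.-1 else 0.
pose r m k : R := Ebin m.-1 (q m k) (fun j => W' (m - j)%N (k + j).-1).
have fixp : forall s : nat * nat, exists2 v : R, 0 <= v &
    state n s.1 s.2 -> v = Num.min (enter_cost w q s.1 s.2) (1 + r s.1 s.2 + b s.1 s.2 * v).
  move=> [m k] /=; have [smk|_] := boolP (state n m k); last by exists 0.
  have p01 := strategy01 q01 smk; have /andP[p0 p1] := p01.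
  have [||||v v0 vE] := @min_fixpoint _ (b m k) (enter_cost w q m k) (r m k).
  - case: k {smk} p0 p1 p01 => [|k] p0 p1 p01; rewrite /b ?lexx ?ler01//.
    by rewrite exprn_ge0 ?subr_ge0// exprn_ile1// ?subr_ge0// gerBl.
  - exact: enter_cost_ge0.
  - by apply: Ebin_ge0.
  - case: k {smk} p0 p1 p01 => [|k] p0 p1 p01; rewrite /b /enter_cost; last first.
      by move=> /esym/eqP; rewrite oner_eq0.
    (* If an idle step is certain, no other agent enters and entering is free. *)
    move=> E; have := exp1B_bernoulli m.-1 p01; rewrite E mul1r => h.
    have : 0 <= m.-1%:R * q m 0%N by rewrite mulr_ge0.
    move=> h'; have -> : m.-1%:R * q m 0%N = 0 by lra.
    by rewrite mul0r addr0 mulr0.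
  by exists v.
have [V V0 VE] := all_sig2 (fun s => cid2 (fixp s)).
pose W2 (m k : nat) : R := if (2 * m + k == N)%N then V (m, k) else W' m k.
have W20 m k : 0 <= W2 m k by rewrite /W2; case: ifP.
exists W2 => // m k smk; rewrite ltnS leq_eqVlt => /orP[/eqP mkN|mkN].
  have stE : stay_cost q W2 m k = 1 + r m k + b m k * V (m, k).
    rewrite /stay_cost -addrA; congr (_ + _); rewrite /r /b.
    case: k smk mkN => [|k] smk mkN.
      rewrite -Ebin_eq0 mulrC -EbinZ -EbinD; apply: eq_Ebin => -[|j] jm /=.
        by rewrite subn0 addn0 /= /W2 /W' mkN eqxx ltnn mulr1 add0r.
      rewrite /= mulr0 addr0 /W2 ifF//; apply/negbTE.
      by move: smk; rewrite /state; lia.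
    rewrite mul0r addr0; apply: eq_Ebin => j jm; rewrite /W2 ifF//.
    by apply/negbTE; move: smk; rewrite /state; lia.
  by rewrite stE {1}/W2 mkN eqxx; exact: VE.
have W2E m' k' : (2 * m' + k' < N)%N -> W2 m' k' = W m' k'.
  by move=> lt; rewrite /W2 /W' lt ifF// ltn_eqF.
rewrite W2E// WE//; congr (Num.min _ (_ + _)); apply: eq_Ebin => j jm.
by rewrite W2E//; move: smk; rewrite /state; lia.
Qed.

Lemma value_exists : exists2 W : nat -> nat -> R,
  forall m k, 0 <= W m k &
  forall m k, state n m k ->
    W m k = Num.min (enter_cost w q m k) (stay_cost q W m k).
Proof.
have [W W0 WE] := value_exists_below (2 * n + n).+1; exists W => // m k smk.
by apply: WE => //; move: smk; rewrite /state; lia.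
Qed.

End Value.

(** * Structure and cost of an equilibrium *)

Section Equilibrium.
Context {R : realType} (n : nat) (w : R) (q : @strategy R) (i : 'I_n).
Context (w2 : 2 < w) (eq_q : sym_equilibrium n w q).
Context (W : nat -> nat -> R) (W0 : forall m k, 0 <= W m k).
Context (WE : forall m k, state n m k ->
  W m k = Num.min (enter_cost w q m k) (stay_cost q W m k)).

Let w0 : 0 <= w. Proof. by apply: ltW; apply: lt_trans w2. Qed.
Let q01 : is_strategy n q. Proof. by case: eq_q. Qed.

Let W_le_enter m k : state n m k -> W m k <= enter_cost w q m k.
Proof. by move=> /WE->; rewrite ge_min lexx. Qed.

Let W_le_stay m k : state n m k -> W m k <= stay_cost q W m k.
Proof. by move=> /WE->; rewrite ge_min lexx orbT. Qed.

Definition slack (m k : nat) : R := bellman w q q W m k - W m k.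

(** The linear part of [bellman w q q]: the mean of [G] at the next state, restricted to the event
    that the agent stays out. *)
Definition drift (G : nat -> nat -> R) (m k : nat) : R :=
  (1 - q m k) * Ebin m.-1 (q m k) (fun j => G (m - j)%N (k + j).-1).

(** The greedy response, which takes the cheaper action in every state, is an admissible deviation
    of cost at most [W n 0]. *)
Lemma equilibrium_cost_le : (expected_cost w (sym_profile q) i <= (W n 0%N)%:E)%E.
Proof.
pose q' : @strategy R := fun m k => (enter_cost w q m k <= stay_cost q W m k)%R%:R.
have q'01 : is_strategy n q'.
  by move=> m k _ _; rewrite /q'; case: (enter_cost _ _ _ _ <= _) => /=; rewrite ?lexx ?ler01.
apply: le_trans (proj2 eq_q i q' q'01) _.
apply: (cost_le i q'01 q01 w0) => // m k smk.
rewrite /bellman [leRHS]WE// /q' minEle; case: ifP => _ /=.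
  by rewrite subrr mul0r addr0 mul1r.
by rewrite subr0 mul0r add0r mul1r.
Qed.

Lemma slack_ge0 m k : state n m k -> 0 <= slack m k.
Proof.
move=> smk; have /andP[p0 p1] := strategy01 q01 smk.
rewrite /slack /bellman; have h1 : 0 <= q m k * (enter_cost w q m k - W m k).
  by rewrite mulr_ge0// subr_ge0 W_le_enter.
have h2 : 0 <= (1 - q m k) * (stay_cost q W m k - W m k).
  by rewrite mulr_ge0// subr_ge0// W_le_stay.
lra.
Qed.

Lemma iter_drift_ge0 t m k : state n m k -> 0 <= iter t drift slack m k.
Proof.
elim: t m k => [|t IH] m k smk; first exact: slack_ge0.
have /andP[p0 p1] := strategy01 q01 smk.
rewrite /= /drift mulr_ge0 ?subr_ge0//; apply: Ebin_ge0 => [|j jm].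
  exact: (strategy01 q01 smk).
by apply: IH; exact: state_next.
Qed.

(** Consecutive iterates of an affine operator differ by its linear part iterated on the first
    difference, here [slack]. *)
Lemma iter_bellmanS N m k : iter N.+1 (bellman w q q) W m k
  = iter N (bellman w q q) W m k + iter N drift slack m k.
Proof.
elim: N m k => [|N IH] m k; first by rewrite /= /slack addrC subrK.
transitivity (q m k * enter_cost w q m k + (1 - q m k) *
    (1 + Ebin m.-1 (q m k) (fun j =>
      iter N (bellman w q q) W (m - j)%N (k + j).-1 +
      iter N drift slack (m - j)%N (k + j).-1))).
  by congr (_ + _ * (1 + _)); apply: eq_Ebin => j _; exact: IH.
rewrite EbinD; set a := Ebin _ _ _; set b := Ebin _ _ _.
by transitivity (q m k * enter_cost w q m k + (1 - q m k) * (1 + a) + (1 - q m k) * b);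
  [ring|].
Qed.

(* The total cost under q exceeds W n 0 by the expected sum of the slacks met. *)
Lemma equilibrium_cost_ge t :
  ((W n 0%N + iter t drift slack n 0%N)%:E <= expected_cost w (sym_profile q) i)%E.
Proof.
rewrite -(deviation_id i).
apply: (@cost_ge _ _ _ _ _ _ q01 q01 w0 W (w * (n%:R + n%:R)) _ t.+1).
  move=> m k smk; apply: (le_trans (W_le_enter smk)); rewrite ler_wpM2l//.
  have /andP[p0 p1] := strategy01 q01 smk.
  have h1 : k%:R <= n%:R :> R by rewrite ler_nat; move: smk; rewrite /state; lia.
  have h2 : m.-1%:R <= n%:R :> R by rewrite ler_nat; move: smk; rewrite /state; lia.
  have h3 : m.-1%:R * q m k <= m.-1%:R by rewrite ler_piMr.
  have : 0 <= m.-1%:R :> R by [].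
  lra.
have sn := state_init i.
have iterW N : W n 0%N <= iter N (bellman w q q) W n 0%N.
  by elim: N => // N IH; rewrite iter_bellmanS (le_trans IH)// lerDl iter_drift_ge0.
elim=> // N IH; rewrite ltnS leq_eqVlt => /orP[/eqP<-|tN].
  by rewrite iter_bellmanS lerD2r.
by rewrite iter_bellmanS (le_trans (IH tN))// lerDl iter_drift_ge0.
Qed.

Lemma equilibrium_costE : expected_cost w (sym_profile q) i = (W n 0%N)%:E.
Proof.
apply/eqP; rewrite eq_le equilibrium_cost_le/=.
apply: le_trans (equilibrium_cost_ge 0); rewrite lee_fin lerDl.
exact: slack_ge0 (state_init i).
Qed.

(* A surrogate for reachability under q: no slack is met when starting from (m, k). *)
Definition tight (m k : nat) : Prop :=
  state n m k /\ forall t, iter t drift slack m k <= 0.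

(** The upper and lower bounds on the equilibrium cost leave no room for slack. *)
Lemma tight_init : tight n 0.
Proof.
split; first exact: state_init i.
move=> t; have := le_trans (equilibrium_cost_ge t) equilibrium_cost_le.
by rewrite lee_fin gerDl.
Qed.

Lemma tight_next m k j : tight m k -> q m k < 1 -> (j <= m.-1)%N ->
  (0 < q m k) || (j == 0%N) -> tight (m - j) (k + j).-1.
Proof.
move=> [smk st] q1 jm qj; split; first exact: state_next.
have /andP[p0 p1] := strategy01 q01 smk.
move=> t; apply: (@Ebin_eq0_support _ m.-1 (q m k)
  (fun j => iter t drift slack (m - j)%N (k + j).-1)) => //.
- by rewrite p0.
- by move=> j' jm'; apply: iter_drift_ge0; exact: state_next.
- by have := st t.+1; rewrite iterS /drift pmulr_rle0// subr_gt0.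
Qed.

Lemma tight_bellman m k : tight m k ->
  q m k * enter_cost w q m k + (1 - q m k) * stay_cost q W m k <= W m k.
Proof. by move=> [_ /(_ 0%N)]; rewrite /= /slack subr_le0. Qed.

(** A lone agent can let the queue empty at cost 1 per step and then enter for free. *)
Lemma value_alone_le k : state n 1 k -> W 1 k <= k%:R.
Proof.
elim: k => [|k IH] s1k.
  by apply: le_trans (W_le_enter s1k) _; rewrite /enter_cost /= !mul0r addr0 mulr0.
apply: le_trans (W_le_stay s1k) _; rewrite /stay_cost /= addn0 -natr1 addrC lerD2r.
by apply: IH; move: s1k; rewrite /state; lia.
Qed.

Lemma tight_lt1 m k : tight m k -> (1 < m + k)%N -> q m k < 1.
Proof.
move=> tmk mk; have [smk _] := tmk; have /andP[p0 p1] := strategy01 q01 smk.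
rewrite lt_neqAle p1 andbT; apply/eqP => q1.
have := tight_bellman tmk; rewrite q1 subrr mul0r addr0 mul1r => h.
have := le_trans h (W_le_stay smk); rewrite /stay_cost /enter_cost q1 Ebin_p1 => {}h.
have [m0 smkn] := andP smk.
have mm : (m - m.-1)%N = 1%N by lia.
have : W (m - m.-1) (k + m.-1).-1 <= (k + m.-1).-1%:R.
  by rewrite mm; apply: value_alone_le; move: smk; rewrite /state; lia.
have -> : (k + m.-1).-1%:R = k%:R + m.-1%:R - 1 :> R.
  by rewrite -natrD -subn1 natrB//; lia.
(* Entering would exceed waiting by at least this quantity plus [k]. *)
have : 0 < (w - 2) * (k%:R + m.-1%:R / 2).
  rewrite mulr_gt0 ?subr_gt0//.
  have : 1 <= k%:R + m.-1%:R :> R by rewrite -natrD ler1n; lia.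
  have : 0 <= k%:R :> R by [].
  lra.
have : 0 <= k%:R :> R by [].
by move: h; rewrite mulr1; lra.
Qed.

(** Staying out has positive probability, so zero slack makes it optimal. *)
Lemma tight_stay m k : tight m k -> (1 < m + k)%N -> W m k = stay_cost q W m k.
Proof.
move=> tmk mk; have [smk _] := tmk; apply/eqP; rewrite eq_le W_le_stay//=.
have q1 := tight_lt1 tmk mk; have /andP[p0 _] := strategy01 q01 smk.
have h : q m k * W m k <= q m k * enter_cost w q m k by rewrite ler_wpM2l// W_le_enter.
have h' := tight_bellman tmk.
by rewrite -(ler_pM2l (_ : 0 < 1 - q m k)) ?subr_gt0//; lra.
Qed.

Lemma tight_next_rank m k j : tight m k -> (1 < m + k)%N -> (j <= m.-1)%N ->
  (0 < q m k) || (j == 0%N) -> tight (m - j) (k + j).-1.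
Proof. by move=> tmk mk; apply: tight_next => //; exact: tight_lt1. Qed.

(** Staying out is optimal until the agent is alone, and the others leave at most one per step. *)
Lemma tight_value_ge m k : tight m k -> (m + k).-1%:R <= W m k.
Proof.
have [N] := ubnP (2 * m + k); elim: N m k => // N IH m k; rewrite ltnS => mkN tmk.
have [smk _] := tmk; have /andP[m0 _] := smk; have p01 := strategy01 q01 smk.
have [mk|mk] := leqP (m + k) 1.
  by have -> : (m + k).-1 = 0%N by lia.
have mkE : (m + k).-1%:R = 1 + (m + k).-2%:R :> R by rewrite nat1r; congr _%:R; lia.
have next j : (j <= m.-1)%N -> (0 < q m k) || (j == 0%N) -> (0 < k + j)%N ->
    (m + k).-2%:R <= W (m - j) (k + j).-1.
  move=> jm qj kj; have -> : (m + k).-2 = (m - j + (k + j).-1).-1 by lia.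
  by apply: IH; [lia|exact: tight_next_rank].
rewrite (tight_stay tmk mk) mkE lerD2l.
case: k => [|k] in smk p01 mk mkN tmk next mkE *; last first.
  rewrite -[leLHS](Ebin_cst m.-1 (q m k.+1)); apply: ler_Ebin => // j jm qj.
  by apply: next; rewrite // addSn.
(* The idle step repeats the state, so the induction hypothesis does not cover it. Instead
   [x >= 1 + x * b], with [b] the idle probability, excludes [x < 0]. *)
set a := (m + 0).-2%:R in next *; pose x := W m 0%N - a.
have h : a + x * (1 - q m 0%N) ^+ m.-1
    <= Ebin m.-1 (q m 0%N) (fun j => W (m - j)%N (0 + j).-1).
  rewrite -Ebin_eq0 -EbinZ -[a in leLHS](Ebin_cst m.-1 (q m 0%N)) -EbinD.
  apply: ler_Ebin => // -[|j] jm qj /=; first by rewrite subn0 mulr1 /x; lra.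
  by rewrite mulr0 addr0; exact: next.
have [p0 p1] := andP p01; have b0 : 0 <= (1 - q m 0%N) ^+ m.-1.
  by rewrite exprn_ge0// subr_ge0.
have b1 : (1 - q m 0%N) ^+ m.-1 <= 1 by rewrite exprn_ile1// ?subr_ge0// gerBl.
have xE : x = 1 + Ebin m.-1 (q m 0%N) (fun j => W (m - j)%N (0 + j).-1) - a.
  by rewrite /x (tight_stay tmk mk).
apply: le_trans (h); rewrite lerDl mulr_ge0//.
rewrite leNgt; apply/negP => x0.
have : x * (1 - (1 - q m 0%N) ^+ m.-1) <= 0 by rewrite nmulr_rle0// subr_ge0.
lra.
Qed.

(** At a tight state with an empty queue and at least two agents outside, [r] bounds the probability
    of staying out. *)
Let r : R := 1 - 2 / w.
Let C : R := w / 2.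

Lemma tight_entry_ge m : tight m 0 -> (1 < m)%N -> 2 / w <= q m 0%N.
Proof.
move=> tm m1; have [sm _] := tm.
have := le_trans (tight_value_ge tm) (W_le_enter sm).
have wp : 0 < w by apply: lt_trans w2.
rewrite addn0 /enter_cost add0r => h.
have m0 : 0 < m.-1%:R :> R by rewrite ltr0n; lia.
by rewrite ler_pdivrMr// -(ler_pM2l m0); lra.
Qed.

(* The geometric term bounds the expected number of idle steps. *)
Lemma tight_value_le m k : tight m k ->
  W m k <= (m + k).-1%:R + C ^+ 2 * (1 - r ^+ m).
Proof.
have wp : 0 < w by apply: lt_trans w2.
have wn0 : w != 0 by rewrite gt_eqF.
have r0 : 0 <= r by rewrite subr_ge0 ler_pdivrMr// mul1r ltW.
have r1 : r < 1 by rewrite /r gtrBl divr_gt0.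
have Cr : C * (1 - r) = 1 by rewrite /C /r; field.
have C1 : 1 <= C by rewrite /C ler_pdivlMr// mul1r ltW.
(* As [C = 1 / (1 - r)], this is the sum of [C * r ^+ j] over [j < m]; the term [j] bounds the
   expected idle time while [j] others are outside. *)
pose I m := C ^+ 2 * (1 - r ^+ m).
have IS j : I j.+1 = I j + C * r ^+ j.
  rewrite /I [r ^+ j.+1]exprS expr2.
  by have -> : C * r ^+ j = C * (1 - r) * (C * r ^+ j); [rewrite Cr mul1r|ring].
have I0 j : 0 <= I j by rewrite mulr_ge0 ?exprn_ge0 ?subr_ge0 ?exprn_ile1 ?(ltW r1)//; lra.
have Imono a b : (a <= b)%N -> I a <= I b.
  move=> ab; rewrite ler_wpM2l ?exprn_ge0//; first by lra.
  by rewrite lerD2l lerN2 ler_wiXn2l// ltW.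
rewrite -/(I m); have [N] := ubnP (2 * m + k).
elim: N m k => // N IH m k; rewrite ltnS => mkN tmk.
have [smk _] := tmk; have /andP[m0 _] := smk; have p01 := strategy01 q01 smk.
have [mk|mk] := leqP (m + k) 1.
  have [m1 k0] : m = 1%N /\ k = 0%N by lia.
  subst m k; apply: le_trans (value_alone_le smk) _.
  by rewrite add0r.
have mkE : (m + k).-1%:R = 1 + (m + k).-2%:R :> R by rewrite nat1r; congr _%:R; lia.
have next j : (j <= m.-1)%N -> (0 < q m k) || (j == 0%N) -> (0 < k + j)%N ->
    W (m - j) (k + j).-1 <= (m + k).-2%:R + I (m - j)%N.
  move=> jm qj kj; have -> : (m + k).-2 = (m - j + (k + j).-1).-1 by lia.
  by apply: IH; [lia|exact: tight_next_rank].
rewrite (tight_stay tmk mk) mkE -addrA lerD2l.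
case: k => [|k] in smk p01 mk mkN tmk next mkE *; last first.
  rewrite -[leRHS](Ebin_cst m.-1 (q m k.+1)); apply: ler_Ebin => // j jm qj.
  apply: le_trans (next j jm qj _) _; first by rewrite addSn.
  by rewrite lerD2l Imono// leq_subr.
case: m => // m in m0 smk p01 mk mkN tmk next mkE *.
have mk' := mk; rewrite addn0 /= in mk mkE next *; have [p0 p1] := andP p01.
set p := q _ _ in p0 p1 p01 *; set a := m.-1%:R in mkE next *.
pose x := W m.+1 0%N - (a + I m).
have h : Ebin m p (fun j => W (m.+1 - j)%N (0 + j).-1) <= (a + I m) + x * (1 - p) ^+ m.
  rewrite -Ebin_eq0 -EbinZ -[a + I m in leRHS](Ebin_cst m p) -EbinD.
  apply: ler_Ebin => // -[|j] jm qj /=; first by rewrite subn0 mulr1 /x; lra.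
  rewrite mulr0 addr0; apply: le_trans (next j.+1 jm qj _) _ => //.
  by rewrite lerD2l Imono// subSS leq_subr.
have xE : x = 1 + Ebin m p (fun j => W (m.+1 - j)%N (0 + j).-1) - (a + I m).
  by rewrite /x (tight_stay tmk mk').
set b := (1 - p) ^+ m in h; set y := r ^+ m.
have b0 : 0 <= b by rewrite exprn_ge0// subr_ge0.
have y0 : 0 <= y by rewrite exprn_ge0.
have by_ : b <= y.
  have pr : 1 - p <= r by rewrite /r lerD2l lerN2 tight_entry_ge.
  by apply: lerXn2r => //; rewrite nnegrE// subr_ge0.
have yr : y <= r.
  by rewrite -[leRHS]expr1 ler_wiXn2l// ?ltW//; lia.
have xb : x * (1 - b) <= 1 by lra.
(* Indeed [1 / (1 - b) = 1 + b / (1 - b)], where [b <= y] and [1 - b >= 1 - r = 1 / C]. *)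
suff : x <= 1 + C * y by rewrite IS -/y; lra.
have b1 : 0 < 1 - b by lra.
rewrite -(ler_pM2r b1); apply: le_trans xb _.
have C0 : 0 <= C by lra.
have t1 : 0 <= (1 + C * y) * (y - b) by rewrite mulr_ge0 ?subr_ge0// addr_ge0// mulr_ge0.
have t2 : 0 <= y * (C * (r - y)) by rewrite !mulr_ge0// subr_ge0.
have t3 : y * (C * (1 - r)) = y by rewrite Cr mulr1.
lra.
Qed.

End Equilibrium.

(** * Comparison of the equilibrium cost with the optimum *)

Lemma equilibrium_cost (R : realType) (n : nat) (w : R) (q : @strategy R) (i : 'I_n) :
  2 < w -> sym_equilibrium n w q ->
  exists2 v, expected_cost w (sym_profile q) i = v%:E &
    n.-1%:R <= v <= n.-1%:R + (w / 2) ^+ 2.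
Proof.
move=> w2 eq_q; have [q01 _] := eq_q.
have w0 : 0 <= w by apply: ltW; apply: lt_trans w2.
have [W W0 WE] := value_exists w0 q01.
have t0 := tight_init i w2 eq_q W0 WE.
exists (W n 0%N); first exact: (equilibrium_costE i w2 eq_q W0 WE).
apply/andP; split.
  by rewrite -[n in n.-1]addn0; exact: (tight_value_ge w2 eq_q W0 WE).
apply: le_trans (tight_value_le w2 eq_q W0 WE t0) _.
rewrite addn0 lerD2l -[leRHS]mulr1 ler_wpM2l ?exprn_ge0 ?divr_ge0// gerBl exprn_ge0//.
by rewrite subr_ge0 ler_pdivrMr ?mul1r 1?ltW// (lt_trans _ w2).
Qed.

Lemma opt_cost_bounds (R : realType) (n K : nat) (w : R) :
  1 <= w -> (0 < n)%N -> (0 < K)%N ->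
  exists2 o, opt_cost n w = o%:E & n%:R * (n.-1%:R / 2) <= o <=
    n%:R * ((1 / 2 + 1 / (2 * K%:R * (1 + K%:R))) * n%:R + w * K%:R / 2).
Proof.
move=> w1; case: n => // n _ K0; have w0 : 0 <= w by exact: le_trans w1.
pose i : 'I_n.+1 := ord0.
have ge : ((n.+1%:R * (n.+1.-1%:R / 2))%:E <= opt_cost n.+1 w)%E.
  apply: le_ereal_inf_tmp => _ [q q01 <-]; rewrite (social_costE w q i) EFinM.
  by rewrite lee_wpmul2l ?lee_fin// sym_cost_ge.
have : (opt_cost n.+1 w <= (n.+1%:R * ((1 / 2 + 1 / (2 * K%:R * (1 + K%:R)))
    * n.+1%:R + w * K%:R / 2))%:E)%E.
  apply: (@le_trans _ _ (social_cost n.+1 w (batch K))).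
    by apply: ereal_inf_lbound; exists (batch K) => //; exact: batch_strategy.
  rewrite (social_costE w _ i) [leRHS]EFinM.
  by rewrite lee_wpmul2l ?lee_fin// batch_cost_le.
move: ge; case: (opt_cost _ _) => // o; rewrite !lee_fin => o1 o2.
by exists o => //; apply/andP.
Qed.

Theorem theorem1p3 (R : realType) (w : R) (hw : 2 < w) (eps : R) (heps : 0 < eps) :
  exists n0 : nat, forall n : nat, (2 <= n)%N -> (n0 < n)%N ->
    forall q : @strategy R, sym_equilibrium n w q ->
      ((2 - eps)%:E <= social_cost n w q / opt_cost n w <= (2 + eps)%:E)%E.
Proof.
have e4 : 0 < 4 / eps by rewrite divr_gt0.
(* This batch size keeps the excess of the slope over [1 / 2], times [2 - eps], below [eps / 4]. *)
pose K := Num.bound (4 / eps); have ltK : 4 / eps < K%:R by apply: archi_boundP; exact: ltW.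
have KR : 0 < K%:R :> R by apply: lt_trans ltK.
have K0 : (0 < K)%N by rewrite -(ltr0n R).
pose b := w * K%:R / 2; pose D := (w / 2) ^+ 2.
have b0 : 0 <= b by rewrite divr_ge0// mulr_ge0//; lra.
have D0 : 0 <= D by rewrite sqr_ge0.
(* For [n >= X], [(n - 1) * eps] absorbs the terms independent of [n]: [b] from the batches and [D]
   from the idle time. *)
pose X := (4 * (2 * b + 1) + 2 * D) / eps + 1.
have X0 : 0 <= X by rewrite addr_ge0// divr_ge0// ?(ltW heps)//; lra.
exists (Num.bound X) => n n2 Xn q eq_q.
have {}Xn : X <= n%:R.
  by apply/ltW/(lt_le_trans (archi_boundP X0)); rewrite ler_nat ltnW.
have n0 : (0 < n)%N by exact: ltnW.
have nR : n%:R = n.-1%:R + 1 :> R by rewrite natr1 prednK.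
have n1R : 1 <= n.-1%:R :> R by rewrite ler1n; lia.
have nep : 4 * (2 * b + 1) + 2 * D <= n.-1%:R * eps.
  by rewrite -ler_pdivrMr//; rewrite /X in Xn; lra.
pose i : 'I_n := Ordinal n0.
have [v vE /andP[v1 v2]] := equilibrium_cost i hw eq_q.
have [|z zE /andP[z1 z2]] := @opt_cost_bounds R n K w _ n0 K0; first by lra.
have np : 0 < n%:R :> R by rewrite ltr0n.
have z0 : 0 < z by apply: lt_le_trans z1; rewrite mulr_gt0// divr_gt0//; lra.
rewrite (social_costE w q i) vE zE inver gt_eqF// -!EFinM !lee_fin.
rewrite ler_pdivlMr// ler_pdivrMr//; apply/andP; split.
  apply: (@le_trans _ _ (n%:R * n.-1%:R)); last by rewrite ler_pM2l.
  (* For [eps > 2] the lower bound is negative and holds trivially. *)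
  have [e2|e2] := leP eps 2; last first.
    by apply: (@le_trans _ _ 0); rewrite ?mulr_ge0// mulr_le0_ge0//; lra.
  apply: (@le_trans _ _ ((2 - eps) * (n%:R *
      ((1 / 2 + 1 / (2 * K%:R * (1 + K%:R))) * n%:R + b)))).
    by rewrite ler_wpM2l// subr_ge0.
  rewrite mulrCA ler_pM2l//.
  have inv4 : (2 - eps) * (1 / (2 * K%:R * (1 + K%:R))) <= eps / 4.
    rewrite mulrA mulr1 ler_pdivrMr; last by rewrite !mulr_gt0// addr_gt0.
    have Ke : 4 <= K%:R * eps by rewrite -ler_pdivrMr// ltW.
    have : 1 * 4 <= (1 + K%:R) * (K%:R * eps) by apply: ler_pM => //; lra.
    lra.
  have h1 : (2 - eps) * (1 / (2 * K%:R * (1 + K%:R))) * n%:R <= eps / 4 * n%:R.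
    by rewrite ler_pM2r.
  move: h1; set t := 1 / (2 * _ * _) => h1.
  have h3 : n%:R * eps = n.-1%:R * eps + eps by rewrite nR mulrDl mul1r.
  have h2 : 0 <= eps * b by rewrite mulr_ge0// ltW.
  lra.
apply: (@le_trans _ _ (n%:R * (n.-1%:R + D))); first by rewrite ler_pM2l.
apply: (@le_trans _ _ ((2 + eps) * (n%:R * (n.-1%:R / 2)))).
  by rewrite mulrCA ler_pM2l//; lra.
by rewrite ler_wpM2l//; lra.
Qed.
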